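(* Let $\alpha_0,\dots,\alpha_5$ be complex parameters with $2\alpha_0+\alpha_1+\alpha_2+\alpha_3+\alpha_4+\alpha_5=1$, and consider the Hamiltonian system $$dq_i=\frac{\partial H_1}{\partial p_i}dt+\frac{\partial H_2}{\partial p_i}ds,\qquad dp_i=-\frac{\partial H_1}{\partial q_i}dt-\frac{\partial H_2}{\partial q_i}ds\qquad(i=1,2)$$ with the Hamiltonians $H_1,H_2$ given in the context. The birational and symplectic transformation $$Q_1=\frac{q_1-q_2}{(s-1)q_2},\quad P_1=(s-1)p_1q_2,\quad Q_2=\frac{s(q_2-1)}{(s-1)q_2},\quad P_2=\frac{(s-1)q_2(q_1p_1+q_2p_2+\alpha_0)}{s},$$ $$T=\frac{t-1}{s-1},\qquad S=\frac{s(t-1)}{t(s-1)}$$ takes this system into the Garnier system in two variables $$dQ_i=\frac{\partial L_1}{\partial P_i}dT+\frac{\partial L_2}{\partial P_i}dS,\qquad dP_i=-\frac{\partial L_1}{\partial Q_i}dT-\frac{\partial L_2}{\partial Q_i}dS\qquad(i=1,2)$$ with canonical polynomial Hamiltonians $$\begin{aligned} L_1=&\,H_{VI}(Q_1,P_1,T;\alpha_1+\alpha_5,\alpha_2,\alpha_0,\alpha_4,\alpha_3)-\frac{\alpha_1S}{T(T-S)}Q_1P_1+\frac{(S-1)Q_2P_2(2Q_1P_1-\alpha_3)}{(T-S)(T-1)}\\ &-\frac{T(Q_1P_1-\alpha_3)P_1Q_2+S(Q_2P_2-\alpha_1)Q_1P_2}{T(T-S)}+\frac{\{2(Q_1P_1+\alpha_0)+Q_2P_2+\alpha_2\}Q_1Q_2P_2}{T(T-1)},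 \end{aligned}$$ and $L_2$ obtained from $L_1$ by the substitution $(Q_1,P_1,Q_2,P_2,T,S;\alpha_0,\alpha_1,\alpha_2,\alpha_3,\alpha_4,\alpha_5)\to(Q_2,P_2,Q_1,P_1,S,T;\alpha_0,\alpha_3,\alpha_2,\alpha_1,\alpha_4,\alpha_5)$.
   Context: The Hamiltonian $H_1$ is given by $$\begin{aligned} &(t-s)(t-1)t(2\alpha_0+\alpha_1+\alpha_2+\alpha_3+\alpha_4+\alpha_5)H_1\\ &=(t-1)\{(q_1-s)(q_1-t)q_1p_1^2+\alpha_0(\alpha_0+\alpha_1)q_1+p_1((t-1)(q_1(\alpha_3+\alpha_4)-s\alpha_3)\\ &\quad+(2\alpha_0+\alpha_1)(q_1-s)q_1+\alpha_2(q_1-s)(q_1-1)+\alpha_3(q_1-s)-\alpha_4(s-1)q_1)\}\\ &\quad-s\{(q_2-t)(q_2-1)q_2p_2^2+\alpha_0(\alpha_0+\alpha_4)q_2+p_2(2\alpha_0(q_2-1)q_2+\alpha_1(t-1)q_2\\ &\quad+\alpha_2t(q_2-1)+\alpha_4(q_2-1)q_2)\}\\ &\quad+(q_1-s)(q_1-t)^2p_1^2q_2+q_1p_2^2(q_2-t)(q_2-1)q_2+\alpha_0(\alpha_0q_1q_2+\alpha_2tq_1+\alpha_4tq_2)\\ &\quad+p_1(2p_2(q_1-s)(q_1-t)(q_2-1)q_2+2\alpha_0(q_1-s)(q_1-t)q_2+\alpha_2(q_1-s)(q_1-1)\\ &\quad+\alpha_4(t-s)(q_1-t)q_2)\\ &\quad+p_2(2\alpha_0q_1(q_2-1)q_2+\alpha_1(t-1)q_1q_2+\alpha_2tq_1(q_2-1)+\alpha_4t(q_2-1)q_2),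 \end{aligned}$$ and $H_2=\pi(H_1)$, where $\pi$ is the substitution exchanging $t\leftrightarrow s$ and $\alpha_4\leftrightarrow\alpha_5$. The symbol $H_{VI}$ denotes $$\begin{aligned}H_{VI}(q,p,t;\beta_0,\beta_1,\beta_2,\beta_3,\beta_4)=\frac1{t(t-1)}[&p^2(q-t)(q-1)q-\{(\beta_0-1)(q-1)q+\beta_3(q-t)q\\&+\beta_4(q-t)(q-1)\}p+\beta_2(\beta_1+\beta_2)(q-t)],\end{aligned}$$ with $\beta_0+\beta_1+2\beta_2+\beta_3+\beta_4=1$. *)

(* Defs.v *)
From mathcomp Require Import all_boot all_order all_algebra complex.
From mathcomp Require mpoly.
(* A full Import of mpoly clashes with the notations of the analysis library. *)
Import (canonicals) mpoly.
From mathcomp Require Import boolp classical_sets reals topology normedtype derive.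

Set Implicit Arguments.
Unset Strict Implicit.
Unset Printing Implicit Defensive.

Import Order.TTheory GRing.Theory Num.Theory.
Import numFieldNormedType.Exports.

Local Open Scope classical_set_scope.
Local Open Scope ring_scope.

(* R[i] packaged as a numFieldType, so that the generic norm, topology and
   differential calculus over a numFieldType apply to it. *)
Definition complexes (R : realType) : numFieldType := R[i].

Section Hamiltonians.
Variable K : fieldType.
Implicit Type a : K.

(* The normalising factor 2 a0 + a1 + ... + a5 is kept in the denominator. *)
Definition H1 a0 a1 a2 a3 a4 a5 (q1 p1 q2 p2 t s : K) : K :=
  ((t - 1) *
     ((q1 - s) * (q1 - t) * q1 * p1 ^+ 2 + a0 * (a0 + a1) * q1
      + p1 * ((t - 1) * (q1 * (a3 + a4) - s * a3)
              + (2 * a0 + a1) * (q1 - s) * q1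
              + a2 * (q1 - s) * (q1 - 1) + a3 * (q1 - s)
              - a4 * (s - 1) * q1))
   - s *
     ((q2 - t) * (q2 - 1) * q2 * p2 ^+ 2 + a0 * (a0 + a4) * q2
      + p2 * (2 * a0 * (q2 - 1) * q2 + a1 * (t - 1) * q2
              + a2 * t * (q2 - 1) + a4 * (q2 - 1) * q2))
   + (q1 - s) * (q1 - t) ^+ 2 * p1 ^+ 2 * q2
   + q1 * p2 ^+ 2 * (q2 - t) * (q2 - 1) * q2
   + a0 * (a0 * q1 * q2 + a2 * t * q1 + a4 * t * q2)
   + p1 * (2 * p2 * (q1 - s) * (q1 - t) * (q2 - 1) * q2
           + 2 * a0 * (q1 - s) * (q1 - t) * q2
           + a2 * (q1 - s) * (q1 - 1)
           + a4 * (t - s) * (q1 - t) * q2)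
   + p2 * (2 * a0 * q1 * (q2 - 1) * q2 + a1 * (t - 1) * q1 * q2
           + a2 * t * q1 * (q2 - 1) + a4 * t * (q2 - 1) * q2))
  / ((t - s) * (t - 1) * t * (2 * a0 + a1 + a2 + a3 + a4 + a5)).

(* The substitution pi exchanges t with s and a4 with a5, and leaves the
   canonical variables unchanged. *)
Definition H2 a0 a1 a2 a3 a4 a5 (q1 p1 q2 p2 t s : K) : K :=
  H1 a0 a1 a2 a3 a5 a4 q1 p1 q2 p2 s t.

(* Meaningful when b0 + b1 + 2 b2 + b3 + b4 = 1; both uses below satisfy this
   as soon as 2 a0 + a1 + a2 + a3 + a4 + a5 = 1. *)
Definition HVI (q p t b0 b1 b2 b3 b4 : K) : K :=
  (t * (t - 1))^-1 *
  (p ^+ 2 * (q - t) * (q - 1) * q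
   - ((b0 - 1) * (q - 1) * q + b3 * (q - t) * q
      + b4 * (q - t) * (q - 1)) * p
   + b2 * (b1 + b2) * (q - t)).

Definition L1 a0 a1 a2 a3 a4 a5 (Q1 P1 Q2 P2 T S : K) : K :=
  HVI Q1 P1 T (a1 + a5) a2 a0 a4 a3
  - a1 * S / (T * (T - S)) * (Q1 * P1)
  + (S - 1) * (Q2 * P2) * (2 * (Q1 * P1) - a3) / ((T - S) * (T - 1))
  - (T * (Q1 * P1 - a3) * P1 * Q2 + S * (Q2 * P2 - a1) * Q1 * P2)
    / (T * (T - S))
  + (2 * (Q1 * P1 + a0) + Q2 * P2 + a2) * Q1 * (Q2 * P2) / (T * (T - 1)).

Definition L2 a0 a1 a2 a3 a4 a5 (Q1 P1 Q2 P2 T S : K) : K :=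
  L1 a0 a3 a2 a1 a4 a5 Q2 P2 Q1 P1 S T.

Definition newQ1 (q1 q2 s : K) : K := (q1 - q2) / ((s - 1) * q2).
Definition newP1 (p1 q2 s : K) : K := (s - 1) * p1 * q2.
Definition newQ2 (q2 s : K) : K := s * (q2 - 1) / ((s - 1) * q2).
Definition newP2 a0 (q1 p1 q2 p2 s : K) : K :=
  (s - 1) * q2 * (q1 * p1 + q2 * p2 + a0) / s.
Definition newT (t s : K) : K := (t - 1) / (s - 1).
Definition newS (t s : K) : K := s * (t - 1) / (t * (s - 1)).

Definition new_times (x : K * K) : K * K := (newT x.1 x.2, newS x.1 x.2).

(* Common singularity-free domain in the times (t, s) of both systems. *)
Definition time_domain : set (K * K) :=
  [set x | [/\ x.1 != 0, x.1 != 1, x.2 != 0, x.2 != 1 & x.1 != x.2]].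

(* The transformation of (q1, p1, q2, p2) at the times x = (t, s). *)
Definition new_phase a0 (x : K * K) (z : K * K * K * K) : K * K * K * K :=
  let: (q1, p1, q2, p2) := z in
  (newQ1 q1 q2 x.2, newP1 p1 q2 x.2, newQ2 q2 x.2, newP2 a0 q1 p1 q2 p2 x.2).

(* The same transformation on all six variables (q1, p1, q2, p2, t, s). *)
Definition transformation a0 (x : 6.-tuple K) : 6.-tuple K :=
  let q1 := x`_0 in let p1 := x`_1 in let q2 := x`_2 in let p2 := x`_3 in
  let t := x`_4 in let s := x`_5 in
  [tuple newQ1 q1 q2 s; newP1 p1 q2 s; newQ2 q2 s; newP2 a0 q1 p1 q2 p2 s;
         newT t s; newS t s].

Definition rational_map n (F : n.-tuple K -> n.-tuple K) : Prop :=
  forall i : 'I_n, exists num den : mpoly.mpoly n K,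
    den != 0 /\
    forall x : n.-tuple K, mpoly.meval (tnth x) den != 0 ->
      tnth (F x) i = mpoly.meval (tnth x) num / mpoly.meval (tnth x) den.

Definition generically n (P : n.-tuple K -> Prop) : Prop :=
  exists2 d : mpoly.mpoly n K, d != 0 &
    forall x : n.-tuple K, mpoly.meval (tnth x) d != 0 -> P x.

Definition birational n (F : n.-tuple K -> n.-tuple K) : Prop :=
  rational_map F /\
  exists G : n.-tuple K -> n.-tuple K,
    [/\ rational_map G,
        generically (fun x => G (F x) = x) &
        generically (fun y => F (G y) = y)].

Definition polynomial_hamiltonian (H : K -> K -> K -> K -> K -> K -> K) : Prop :=
  forall x : K * K, time_domain x ->
  exists h : mpoly.mpoly 4 K, forall q1 p1 q2 p2 : K,
    H q1 p1 q2 p2 x.1 x.2 = mpoly.meval (tnth [tuple q1; p1; q2; p2]) h.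

End Hamiltonians.

Section Systems.
Variable K : numFieldType.

Definition hamiltonian := K -> K -> K -> K -> K -> K -> K.

(* The 2-form dp1 /\ dq1 + dp2 /\ dq2, with vectors ordered as
   (q1, p1, q2, p2). *)
Definition symplectic_form (u v : K * K * K * K) : K :=
  (u.1.1.2 * v.1.1.1 - u.1.1.1 * v.1.1.2) + (u.2 * v.1.2 - u.1.2 * v.2).

Definition symplectic_on (A : set (K * K * K * K))
    (f : K * K * K * K -> K * K * K * K) : Prop :=
  forall z, A z -> differentiable f z /\
    forall u v, symplectic_form ('d f z u) ('d f z v) = symplectic_form u v.

Definition dHq1 (H : hamiltonian) (z : K * K * K * K) (x : K * K) : K :=
  let: (q1, p1, q2, p2) := z in
  derive1 (fun y : K => H y p1 q2 p2 x.1 x.2) q1.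
Definition dHp1 (H : hamiltonian) (z : K * K * K * K) (x : K * K) : K :=
  let: (q1, p1, q2, p2) := z in
  derive1 (fun y : K => H q1 y q2 p2 x.1 x.2) p1.
Definition dHq2 (H : hamiltonian) (z : K * K * K * K) (x : K * K) : K :=
  let: (q1, p1, q2, p2) := z in
  derive1 (fun y : K => H q1 p1 y p2 x.1 x.2) q2.
Definition dHp2 (H : hamiltonian) (z : K * K * K * K) (x : K * K) : K :=
  let: (q1, p1, q2, p2) := z in
  derive1 (fun y : K => H q1 p1 q2 y x.1 x.2) p2.

(* At the times x = (t, s): dq_i = dA/dp_i dt + dB/dp_i ds and
   dp_i = - dA/dq_i dt - dB/dq_i ds, as equalities of the differentials at x of
   the components of z = (q1, p1, q2, p2); h = (dt, ds) is a tangent vector. *)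
Definition hamiltonian_system_at (A B : hamiltonian)
    (z : K * K -> K * K * K * K) (x : K * K) : Prop :=
  [/\ is_diff x (fun y => (z y).1.1.1)
        (fun h : K * K => dHp1 A (z x) x * h.1 + dHp1 B (z x) x * h.2),
      is_diff x (fun y => (z y).1.1.2)
        (fun h : K * K => - dHq1 A (z x) x * h.1 - dHq1 B (z x) x * h.2),
      is_diff x (fun y => (z y).1.2)
        (fun h : K * K => dHp2 A (z x) x * h.1 + dHp2 B (z x) x * h.2) &
      is_diff x (fun y => (z y).2)
        (fun h : K * K => - dHq2 A (z x) x * h.1 - dHq2 B (z x) x * h.2)].

Definition solution_on (A B : hamiltonian) (U : set (K * K))
    (z : K * K -> K * K * K * K) : Prop :=
  forall x, U x -> hamiltonian_system_at A B z x.

End Systems.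

(* Main.v *)
Require Import Defs.
From mathcomp Require Import all_boot all_order all_algebra complex.
From mathcomp Require mpoly.
Import (canonicals) mpoly.
From mathcomp Require Import boolp classical_sets reals topology normedtype derive.
From mathcomp Require Import functions filter landau.
From mathcomp Require Import ring.

Import Order.TTheory GRing.Theory Num.Theory.
Import numFieldNormedType.Exports.

Local Open Scope classical_set_scope.
Local Open Scope ring_scope.

(** At fixed times the map (q, p) |-> (Q, P) is symplectic, so it carries the
    Hamiltonian vector field of L \o Phi to that of L.  It depends on the times
    through s only: Q1 and P1 are multiplied by mutually inverse functions of s,
    and so are Q2 and P2.  Hence its s-derivative is itself a Hamiltonian vector
    field in the new variables, with generator
      M = - Q1 P1 / (s - 1) - Q2 P2 / (s (s - 1)).
    The equivalence of the two systems therefore amounts to an equality of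
    1-forms in dt and ds,
      (L1 dT + L2 dS) \o Phi = H1 dt + (H2 + M \o Phi) ds
    up to terms independent of (q, p), which do not contribute to the vector
    fields.  The dt and ds parts are the rational identities [pullback_dt] and
    [pullback_ds].

    Differentiating these identities in the phase variables and pairing with
    the symplectic form, which is nondegenerate, gives [phase_diff_field]: the
    differential of Phi maps the vector fields of H1 and H2 to the combinations
    of those of L1 and L2 prescribed by the differential of the times, up to
    the s-derivative of Phi.  Thus no partial derivative of the four
    Hamiltonians is ever written out.

    The change of times is an involution of the common domain, so near
    (T, S) the function Z is Phi applied to z composed with that same map;
    differentiating this composite transports solutions forward.  Backward, z is
    the inverse of Phi applied to Z, hence differentiable as soon as Z is, and
    its differential is then determined because that of Phi is injective.

    Birationality rests on the same two inverses, of Phi and of the times,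
    together with the stability of rational functions under field operations.
    *)

Set Implicit Arguments.
Unset Strict Implicit.
Unset Printing Implicit Defensive.

(** * Polynomial and rational functions *)

Section PolynomialFunctions.
Variables (K : fieldType) (n : nat).
Implicit Types (f g : n.-tuple K -> K) (c : K).

Definition polynomial_fun f : Prop :=
  exists h : mpoly.mpoly n K, forall v, f v = mpoly.meval (tnth v) h.

(** The denominator may vanish at points where [f] is still defined by the
    convention 0^-1 = 0; nothing is claimed at such points. *)
Definition rational_fun f : Prop :=
  exists num den : mpoly.mpoly n K, den != 0 /\
    forall v, mpoly.meval (tnth v) den != 0 ->
      f v = mpoly.meval (tnth v) num / mpoly.meval (tnth v) den.

Lemma polynomial_const c : polynomial_fun (fun=> c).
Proof. by exists (mpoly.mpolyC n c) => v; rewrite mpoly.mevalC. Qed.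

Lemma polynomial_proj i : polynomial_fun (fun v => v`_i).
Proof.
have [lt_in|ge_in] := ltnP i n.
  exists (mpoly.mpolyX K (mpoly.mnm1 (Ordinal lt_in))) => v.
  by rewrite mpoly.mevalXU (tnth_nth 0).
by exists 0 => v; rewrite nth_default ?size_tuple// mpoly.meval0.
Qed.

Lemma polynomial_add f g : polynomial_fun f -> polynomial_fun g ->
  polynomial_fun (fun v => f v + g v).
Proof. by move=> [p fp] [q gq]; exists (p + q) => v; rewrite mpoly.mevalD fp gq. Qed.

Lemma polynomial_opp f : polynomial_fun f -> polynomial_fun (fun v => - f v).
Proof. by move=> [p fp]; exists (- p) => v; rewrite mpoly.mevalN fp. Qed.

Lemma polynomial_mul f g : polynomial_fun f -> polynomial_fun g ->
  polynomial_fun (fun v => f v * g v).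
Proof. by move=> [p fp] [q gq]; exists (p * q) => v; rewrite mpoly.mevalM fp gq. Qed.

Lemma polynomial_exp f k : polynomial_fun f -> polynomial_fun (fun v => f v ^+ k).
Proof.
move=> fp; elim: k => [|k IH]; first exact: polynomial_const.
have -> : (fun v => f v ^+ k.+1) = (fun v => f v * f v ^+ k).
  by apply/funext => v; rewrite exprS.
exact: polynomial_mul.
Qed.

Lemma rational_polynomial f : polynomial_fun f -> rational_fun f.
Proof.
move=> [p fp]; exists p, 1; split; first exact: oner_neq0.
by move=> v _; rewrite mpoly.meval1 divr1.
Qed.

Lemma rational_add f g : rational_fun f -> rational_fun g ->
  rational_fun (fun v => f v + g v).
Proof.
move=> [p [d [d0 fp]]] [q [e [e0 gq]]].
exists (p * e + q * d), (d * e); split; first by rewrite mulf_neq0.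
move=> v; rewrite mpoly.mevalD !mpoly.mevalM mulf_eq0 negb_or => /andP[dv ev].
by rewrite fp// gq// addf_div// [mpoly.meval _ d * _]mulrC.
Qed.

Lemma rational_opp f : rational_fun f -> rational_fun (fun v => - f v).
Proof.
move=> [p [d [d0 fp]]]; exists (- p), d; split=> // v dv.
by rewrite fp// mpoly.mevalN mulNr.
Qed.

Lemma rational_mul f g : rational_fun f -> rational_fun g ->
  rational_fun (fun v => f v * g v).
Proof.
move=> [p [d [d0 fp]]] [q [e [e0 gq]]].
exists (p * q), (d * e); split; first by rewrite mulf_neq0.
move=> v; rewrite !mpoly.mevalM mulf_eq0 negb_or => /andP[dv ev].
by rewrite fp// gq// mulf_div.
Qed.

(** If [f] = p / d then 1 / [f] = d^2 / (p d): the extra factor d in the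
    denominator excludes the zeros of d, where [f] is not controlled.  When
    p = 0 this denominator is not allowed, but then 1 / [f] = 0 = f. *)
Lemma rational_inv f : rational_fun f -> rational_fun (fun v => (f v)^-1).
Proof.
move=> [p [d [d0 fp]]]; have [p0|p0] := eqVneq p 0.
  exists 0, d; split=> // v dv.
  have -> : f v = 0 by rewrite fp// p0 (mpoly.meval0 (tnth v) : _ = 0 :> K) mul0r.
  by rewrite invr0 (mpoly.meval0 (tnth v) : _ = 0 :> K) mul0r.
exists (d * d), (p * d); split; first by rewrite mulf_neq0.
move=> v; rewrite !mpoly.mevalM mulf_eq0 negb_or => /andP[pv dv].
by rewrite fp// invf_div -mulf_div divff// mulr1.
Qed.

End PolynomialFunctions.

Ltac polynomiality := repeat first
  [ apply: polynomial_const | apply: polynomial_proj | apply: polynomial_add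
  | apply: polynomial_opp | apply: polynomial_mul | apply: polynomial_exp ].

Ltac rationality := repeat first
  [ apply: rational_polynomial; solve [polynomiality]
  | apply: rational_add | apply: rational_opp | apply: rational_mul
  | apply: rational_inv ].

Section Polynomiality.
Variable K : fieldType.
Implicit Types b : K.

Lemma polynomial_hamiltonianP (H : K -> K -> K -> K -> K -> K -> K) :
  (forall t s, polynomial_fun (fun v : 4.-tuple K => H v`_0 v`_1 v`_2 v`_3 t s)) ->
  polynomial_hamiltonian H.
Proof.
move=> Hp [t s] _; have [h hE] := Hp t s.
by exists h => q1 p1 q2 p2; rewrite -hE.
Qed.

Lemma polynomial_H1 b0 b1 b2 b3 b4 b5 :
  polynomial_hamiltonian (H1 b0 b1 b2 b3 b4 b5).
Proof. by apply: polynomial_hamiltonianP => t s; rewrite /H1; polynomiality. Qed.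

Lemma polynomial_H2 b0 b1 b2 b3 b4 b5 :
  polynomial_hamiltonian (H2 b0 b1 b2 b3 b4 b5).
Proof. by apply: polynomial_hamiltonianP => t s; rewrite /H2 /H1; polynomiality. Qed.

Lemma polynomial_L1 b0 b1 b2 b3 b4 b5 :
  polynomial_hamiltonian (L1 b0 b1 b2 b3 b4 b5).
Proof. by apply: polynomial_hamiltonianP => t s; rewrite /L1 /HVI; polynomiality. Qed.

Lemma polynomial_L2 b0 b1 b2 b3 b4 b5 :
  polynomial_hamiltonian (L2 b0 b1 b2 b3 b4 b5).
Proof. by apply: polynomial_hamiltonianP => t s; rewrite /L2 /L1 /HVI; polynomiality. Qed.

End Polynomiality.

(** * Differential calculus *)

Lemma near_eq_is_diff (K : numFieldType) (V W : normedModType K) (a : V)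
    (f g df : V -> W) :
  (\forall y \near a, f y = g y) -> is_diff a f df -> is_diff a g df.
Proof.
move=> fg [df_a df_val].
have fga : f a = g a by exact: nbhs_singleton fg.
have [cdf expand] := (diff_locallyP _ _).1 df_a.
have cg : g \o shift a = cst (g a) + 'd f a +o_ 0 id.
  apply/eqaddoP => e e0; move/eqaddoP: expand => /(_ e e0).
  apply: filter_app; have : \forall h \near (0 : V), f (h + a) = g (h + a).
    by rewrite (near_shift a) /=; near do rewrite /= sub0r subrK //.
  apply: filter_app; near=> h => fgh; rewrite -fga.
  by rewrite !fctE /= fgh.
have dg : 'd g a = 'd f a :> (V -> W) by apply: diff_unique.
apply: DiffDef; last by rewrite dg.
by apply/diff_locallyP; rewrite dg; split.
Unshelve. all: by end_near. Qed.

(** The rules of differentiation are restated pointwise, with explicit lambda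
    abstractions, so that the derivative of a rational expression can be built
    as a term that follows the shape of the expression. *)
Section Rules.
Variables (K : numFieldType) (V : normedModType K).
Implicit Types (f g df dg : V -> K) (a : V).

Lemma is_diff_add f g df dg a : is_diff a f df -> is_diff a g dg ->
  is_diff a (fun y => f y + g y) (fun h => df h + dg h).
Proof. exact: is_diffD. Qed.

Lemma is_diff_opp f df a :
  is_diff a f df -> is_diff a (fun y => - f y) (fun h => - df h).
Proof. exact: is_diffN. Qed.

Lemma is_diff_mul f g df dg a : is_diff a f df -> is_diff a g dg ->
  is_diff a (fun y => f y * g y) (fun h => f a * dg h + g a * df h).
Proof. exact: is_diffM. Qed.

Lemma is_diff_inv f df a : is_diff a f df -> f a != 0 ->
  is_diff a (fun y => (f y)^-1) (fun h => - (f a) ^- 2 * df h).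
Proof.
move=> [fa <-] fa0; apply: DiffDef; first exact: differentiableV.
by rewrite diffV.
Qed.

Lemma is_diff_const (c : K) a : is_diff a (fun=> c) (fun=> 0).
Proof. exact: is_diff_cst. Qed.

End Rules.

Lemma is_diff_pairP (K : numFieldType) (V W1 W2 : normedModType K) (a : V)
    (f df : V -> W1 * W2) :
  is_diff a f df <-> is_diff a (fun y => (f y).1) (fun h => (df h).1) /\
                     is_diff a (fun y => (f y).2) (fun h => (df h).2).
Proof.
have lin (W' : normedModType K) (p : {linear (W1 * W2)%type -> W'}) :
    continuous p -> is_diff a f df ->
    is_diff a (fun y => p (f y)) (fun h => p (df h)).
  move=> cp fa; apply: (@is_diff_comp _ _ _ _ f df p p a fa).
  by apply: DiffDef; [exact: linear_differentiable|exact: diff_lin].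
split=> [fa|[fa1 fa2]].
  split.
    by apply: (lin _ (@fst W1 W2)) => // p; exact: cvg_fst.
  by apply: (lin _ (@snd W1 W2)) => // p; exact: cvg_snd.
have -> : f = fun y => ((f y).1, (f y).2) by apply/funext => y; case: (f y).
have -> : df = fun y => ((df y).1, (df y).2) by apply/funext => y; case: (df y).
exact: is_diff_pair.
Qed.

Lemma is_diff_unique (K : numFieldType) (V W : normedModType K) (c : V)
    (f df df' : V -> W) :
  is_diff c f df -> is_diff c f df' -> df = df'.
Proof. by move=> [_ <-] [_ <-]. Qed.

Section Differentiability.
Variables (K : numFieldType) (W : normedModType K) (a : W).
Implicit Types f g : W -> K.

Lemma near_neq0 f : differentiable f a -> f a != 0 -> \forall y \near a, f y != 0.
Proof. by move=> /differentiable_continuous fa; exact: cvgr_neq0. Qed.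

Lemma differentiable_prod (I : Type) (r : seq I) (F : I -> W -> K) :
  (forall i, differentiable (F i) a) ->
  differentiable (fun y => \prod_(i <- r) F i y) a.
Proof.
move=> Fa; elim: r => [|i r IH].
  under eq_fun do rewrite big_nil; exact: differentiable_cst.
by under eq_fun do rewrite big_cons; exact: differentiableM.
Qed.

Lemma differentiable_power f k :
  differentiable f a -> differentiable (fun y => f y ^+ k) a.
Proof.
move=> fa; elim: k => [|k IH]; first exact: differentiable_cst.
by under eq_fun do rewrite exprS; exact: differentiableM.
Qed.

Lemma differentiable_meval n (h : mpoly.mpoly n K) (v : W -> 'I_n -> K) :
  (forall i, differentiable (fun y => v y i) a) ->
  differentiable (fun y => mpoly.meval (v y) h) a.
Proof.
move=> va; under eq_fun do rewrite mpoly.mevalE.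
elim: (mpoly.msupp h) => [|m s IH].
  under eq_fun do rewrite big_nil; exact: differentiable_cst.
under eq_fun do rewrite big_cons.
apply: differentiableD => //; apply: differentiableM => //.
by apply: differentiable_prod => i; exact: differentiable_power.
Qed.

End Differentiability.

(** * Hamiltonian vector fields *)

Section HamiltonianFields.
Variable K : numFieldType.
Implicit Types (z u v w : K * K * K * K) (x : K * K).

Lemma symplectic_formD u v w :
  symplectic_form (u + v) w = symplectic_form u w + symplectic_form v w.
Proof. by rewrite /symplectic_form /=; ring. Qed.

Lemma symplectic_formZ (c : K) u w :
  symplectic_form (c *: u) w = c * symplectic_form u w.
Proof. by rewrite /symplectic_form /= /GRing.scale /=; ring. Qed.

(** Nondegeneracy of the symplectic form. *)
Lemma symplectic_form_inj u v :
  (forall w, symplectic_form u w = symplectic_form v w) -> u = v.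
Proof.
case: u => [[[u1 u2] u3] u4]; case: v => [[[v1 v2] v3] v4] uv.
have := uv (1, 0, 0, 0); have := uv (0, 1, 0, 0).
have := uv (0, 0, 1, 0); have := uv (0, 0, 0, 1).
rewrite /symplectic_form /= !(mulr0, mulr1, subr0, sub0r, oppr0, add0r, addr0).
by move=> e3 e4 e1 e2; rewrite (oppr_inj e3) e4 (oppr_inj e1) e2.
Qed.

Definition ham_field (H : hamiltonian K) z x : K * K * K * K :=
  (dHp1 H z x, - dHq1 H z x, dHp2 H z x, - dHq2 H z x).

Definition at_time (H : hamiltonian K) x z : K :=
  H z.1.1.1 z.1.1.2 z.1.2 z.2 x.1 x.2.

Lemma is_diff_coordsP {W : normedModType K} (a : W) (f df : W -> K * K * K * K) :
  is_diff a f df <->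
  [/\ is_diff a (fun y => (f y).1.1.1) (fun h => (df h).1.1.1),
      is_diff a (fun y => (f y).1.1.2) (fun h => (df h).1.1.2),
      is_diff a (fun y => (f y).1.2) (fun h => (df h).1.2) &
      is_diff a (fun y => (f y).2) (fun h => (df h).2)].
Proof.
split.
  by move=> /is_diff_pairP[/is_diff_pairP[/is_diff_pairP[f1 f2] f3] f4].
case=> f1 f2 f3 f4; apply/is_diff_pairP; split=> //.
by apply/is_diff_pairP; split=> //; apply/is_diff_pairP.
Qed.

(** The four scalar equations of a system form a single equation between
    differentials with values in the phase space; this is the form in which
    systems are transported. *)
Lemma hamiltonian_system_atE (A B : hamiltonian K) (z : K * K -> K * K * K * K) x :
  hamiltonian_system_at A B z x <->
  is_diff x z (fun h => h.1 *: ham_field A (z x) x + h.2 *: ham_field B (z x) x).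
Proof.
have comm (a b : K) : (fun h : K * K => a * h.1 + b * h.2) =
    (fun h : K * K => h.1 * a + h.2 * b).
  by apply/funext => h; ring.
have commN (a b : K) : (fun h : K * K => - a * h.1 - b * h.2) =
    (fun h : K * K => h.1 * - a + h.2 * - b).
  by apply/funext => h; ring.
rewrite /hamiltonian_system_at !comm !commN.
apply: iff_sym.
exact: (is_diff_coordsP x z
  (fun h => h.1 *: ham_field A (z x) x + h.2 *: ham_field B (z x) x)).
Qed.

(** A Hamiltonian vector field is characterised by its pairing with the
    symplectic form, which reduces statements about partial derivatives to the
    chain rule for the total differential.  The sign comes from the convention
    dp /\ dq. *)
Lemma ham_field_diff (H : hamiltonian K) z x u :
  differentiable (at_time H x) z ->
  symplectic_form (ham_field H z x) u = - ('d (at_time H x) z : _ -> _) u.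
Proof.
move=> Hz.
(* A partial derivative is the total differential along a line parallel to
   the corresponding axis. *)
have along (e : K * K * K * K) (c : K -> K * K * K * K) a :
    c a = z -> is_diff a c (fun y => y *: e) ->
    derive1 (at_time H x \o c) a = ('d (at_time H x) z : _ -> _) e.
  move=> ca [dc vc]; rewrite derive1E'; last first.
    by apply: differentiable_comp => //; rewrite ca.
  by rewrite diff_comp ?ca //= vc scale1r.
case: z Hz along => [[[q1 p1] q2] p2] Hz along.
have const (c a : K) : is_diff a (fun=> c) (fun y => y * 0).
  have -> : (fun y : K => y * 0) = fun=> 0 by apply/funext => y; rewrite mulr0.
  exact: is_diff_const.
have var (a : K) : is_diff a (fun y => y) (fun y => y * 1).
  have -> : (fun y : K => y * 1) = id by apply/funext => y; rewrite mulr1.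
  exact: is_diff_id.
have -> : u = u.1.1.1 *: (1, 0, 0, 0) + u.1.1.2 *: (0, 1, 0, 0)
            + u.1.2 *: (0, 0, 1, 0) + u.2 *: (0, 0, 0, 1).
  case: u => [[[u1 u2] u3] u4] /=.
  by congr (_, _, _, _); rewrite /= /GRing.scale /=; ring.
rewrite !linearD !linearZ /=.
have D1 : is_diff q1 (fun y => (y, p1, q2, p2)) (fun y => y *: (1, 0, 0, 0)).
  by apply/is_diff_coordsP; split; [exact: var|exact: const..].
have D2 : is_diff p1 (fun y => (q1, y, q2, p2)) (fun y => y *: (0, 1, 0, 0)).
  by apply/is_diff_coordsP; split;
    [exact: const|exact: var|exact: const|exact: const].
have D3 : is_diff q2 (fun y => (q1, p1, y, p2)) (fun y => y *: (0, 0, 1, 0)).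
  by apply/is_diff_coordsP; split;
    [exact: const|exact: const|exact: var|exact: const].
have D4 : is_diff p2 (fun y => (q1, p1, q2, y)) (fun y => y *: (0, 0, 0, 1)).
  by apply/is_diff_coordsP; split;
    [exact: const|exact: const|exact: const|exact: var].
rewrite -(along _ _ _ erefl D1) -(along _ _ _ erefl D2).
rewrite -(along _ _ _ erefl D3) -(along _ _ _ erefl D4).
rewrite /symplectic_form /ham_field /dHq1 /dHp1 /dHq2 /dHp2 /=.
rewrite /GRing.scale /= /comp /at_time /=.
ring.
Qed.

End HamiltonianFields.

Lemma differentiable_hamiltonian (K : numFieldType) (H : hamiltonian K) x z :
  polynomial_hamiltonian H -> time_domain x -> differentiable (at_time H x) z.
Proof.
move=> Hpoly /Hpoly[h hE].
have -> : at_time H x = fun y => mpoly.meval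
    (tnth [tuple y.1.1.1; y.1.1.2; y.1.2; y.2]) h.
  by apply/funext => y; rewrite -hE.
have [[D1 _] [D2 _] [D3 _] [D4 _]] :=
  (@is_diff_coordsP _ _ z id id).1 (is_diff_id z).
by apply: differentiable_meval => -[[|[|[|[|]]]]].
Qed.

(** * The change of times *)

Section TimeMap.
Variable K : fieldType.
Implicit Types (t s : K) (x : K * K).

Lemma newT_sub1 t s : s - 1 != 0 -> newT t s - 1 = (t - s) / (s - 1).
Proof. by move=> s1; rewrite /newT; field. Qed.

Lemma newS_sub1 t s : t != 0 -> s - 1 != 0 ->
  newS t s - 1 = (t - s) / (t * (s - 1)).
Proof. by move=> t0 s1; rewrite /newS; field; rewrite s1 t0. Qed.

Lemma newT_subS t s : t != 0 -> s - 1 != 0 ->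
  newT t s - newS t s = (t - 1) * (t - s) / (t * (s - 1)).
Proof. by move=> t0 s1; rewrite /newT /newS; field; rewrite s1 t0. Qed.

Lemma time_domainE x : time_domain x <->
  [/\ x.1 != 0, x.1 - 1 != 0, x.2 != 0, x.2 - 1 != 0 & x.1 - x.2 != 0].
Proof. by rewrite /time_domain /= !subr_eq0. Qed.

Lemma new_times_domain x : time_domain x -> time_domain (new_times x).
Proof.
case: x => t s /time_domainE[/= t0 t1 s0 s1 ts]; apply/time_domainE.
rewrite /= newT_sub1// newS_sub1// newT_subS// /newT /newS.
by split; rewrite !(mulf_neq0, invr_eq0).
Qed.

(** From S / T = s / t and the definition of T one finds t = (T - 1) / (S - 1)
    and s = S (T - 1) / (T (S - 1)): the change of times is its own inverse. *)
Lemma new_timesK x : time_domain x -> new_times (new_times x) = x.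
Proof.
case: x => t s /time_domainE[/= t0 t1 s0 s1 ts].
rewrite /new_times /= [newT (newT _ _) _]/newT [newS (newT _ _) _]/newS.
rewrite newT_sub1// newS_sub1// /newT /newS.
by congr (_, _); field; rewrite ?t0 ?t1 ?s0 ?s1 ?ts.
Qed.

End TimeMap.

Section TimeDifferential.
Variable K : numFieldType.
Implicit Types (x h : K * K).

Definition times_diff x h : K * K :=
  let t := x.1 in let s := x.2 in
  (h.1 / (s - 1) - (t - 1) / (s - 1) ^+ 2 * h.2,
   s / ((s - 1) * t ^+ 2) * h.1 - (t - 1) / (t * (s - 1) ^+ 2) * h.2).

Lemma is_diff_times x : time_domain x ->
  is_diff x (@new_times K) (times_diff x).
Proof.
move=> /time_domainE[t0 t1 s0 s1 ts].
have [Dt Ds] := (@is_diff_pairP _ _ _ _ x id id).1 (is_diff_id x).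
have Dt1 := is_diff_add Dt (is_diff_const (-1) x).
have Ds1 := is_diff_add Ds (is_diff_const (-1) x).
apply/is_diff_pairP; split.
  apply: is_diff_eq (is_diff_mul Dt1 (is_diff_inv Ds1 s1)) _.
  by apply/funext => h /=; field.
apply: is_diff_eq (is_diff_mul (is_diff_mul Ds Dt1)
  (is_diff_inv (is_diff_mul Dt Ds1) (mulf_neq0 t0 s1))) _.
by apply/funext => h /=; field; rewrite s1 t0.
Qed.

Lemma times_diffK x h : time_domain x ->
  times_diff (new_times x) (times_diff x h) = h.
Proof.
case: x h => t s [u v] /time_domainE[/= t0 t1 s0 s1 ts].
rewrite /times_diff /= newT_sub1// newS_sub1// /newT /newS.
by congr (_, _); field; rewrite ?t0 ?t1 ?s0 ?s1 ?ts.
Qed.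

Lemma near_time_domain x : time_domain x -> \forall y \near x, time_domain y.
Proof.
move=> /time_domainE[t0 t1 s0 s1 ts].
have [Dt Ds] := (@is_diff_pairP _ _ _ _ x id id).1 (is_diff_id x).
have Dt1 := is_diff_add Dt (is_diff_const (-1) x).
have Ds1 := is_diff_add Ds (is_diff_const (-1) x).
have Dts := is_diff_add Dt (is_diff_opp Ds).
near=> y; apply/time_domainE; split; near: y.
- exact: (near_neq0 (@ex_diff _ _ _ _ _ _ _ Dt)).
- exact: (near_neq0 (@ex_diff _ _ _ _ _ _ _ Dt1)).
- exact: (near_neq0 (@ex_diff _ _ _ _ _ _ _ Ds)).
- exact: (near_neq0 (@ex_diff _ _ _ _ _ _ _ Ds1)).
- exact: (near_neq0 (@ex_diff _ _ _ _ _ _ _ Dts)).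
Unshelve. all: by end_near. Qed.

End TimeDifferential.

(** * The phase map *)

Section PhaseMap.
Variable K : numFieldType.
Variable a0 : K.
Implicit Types (z u v w : K * K * K * K) (x : K * K).

Lemma new_phaseE x z : new_phase a0 x z =
  (newQ1 z.1.1.1 z.1.2 x.2, newP1 z.1.1.2 z.1.2 x.2, newQ2 z.1.2 x.2,
   newP2 a0 z.1.1.1 z.1.1.2 z.1.2 z.2 x.2).
Proof. by case: z => [[[q1 p1] q2] p2]. Qed.

(** The differential, in the phase variables only, of the phase map at [z]. *)
Definition phase_diff z (s : K) u : K * K * K * K :=
  let q1 := z.1.1.1 in let p1 := z.1.1.2 in let q2 := z.1.2 in
  let p2 := z.2 in
  let u1 := u.1.1.1 in let v1 := u.1.1.2 in let u2 := u.1.2 in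
  let v2 := u.2 in
  (u1 / ((s - 1) * q2) - q1 * u2 / ((s - 1) * q2 ^+ 2),
   (s - 1) * (v1 * q2 + p1 * u2),
   s * u2 / ((s - 1) * q2 ^+ 2),
   (s - 1) / s * (u2 * (q1 * p1 + q2 * p2 + a0)
                  + q2 * (u1 * p1 + q1 * v1 + u2 * p2 + q2 * v2))).

(** The s-derivative of the phase map, expressed at its image [w].  Its entries
    are the logarithmic derivatives of the scalings 1 / (s - 1), s - 1,
    s / (s - 1) and (s - 1) / s of Q1, P1, Q2 and P2. *)
Definition drift (s : K) w : K * K * K * K :=
  (- w.1.1.1 / (s - 1), w.1.1.2 / (s - 1),
   - w.1.2 / (s * (s - 1)), w.2 / (s * (s - 1))).

(** The components are differentiated as expressions in six abstract functions,
    and the values of these functions are generalised before [field] is called: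
    this keeps the rational identities over variables. *)
Section Components.
Variables (W : normedModType K) (c : W).
Variables (q1 p1 q2 p2 s dq1 dp1 dq2 dp2 ds : W -> K).
Hypothesis Dq1 : is_diff c q1 dq1.
Hypothesis Dp1 : is_diff c p1 dp1.
Hypothesis Dq2 : is_diff c q2 dq2.
Hypothesis Dp2 : is_diff c p2 dp2.
Hypothesis Ds : is_diff c s ds.
Hypothesis q20 : q2 c != 0.
Hypothesis s0 : s c != 0.
Hypothesis s1 : s c - 1 != 0.

Let Ds1 := is_diff_add Ds (is_diff_const (-1) c).
Let Dq21 := is_diff_add Dq2 (is_diff_const (-1) c).
Let Ds1q2 : is_diff c (fun y => ((s y - 1) * q2 y)^-1) _ :=
  is_diff_inv (is_diff_mul Ds1 Dq2) (mulf_neq0 s1 q20).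

Lemma is_diff_newQ1 : is_diff c (fun y => newQ1 (q1 y) (q2 y) (s y))
  (fun h => dq1 h / ((s c - 1) * q2 c) - q1 c * dq2 h / ((s c - 1) * q2 c ^+ 2)
            + ds h * (- newQ1 (q1 c) (q2 c) (s c) / (s c - 1))).
Proof.
apply: is_diff_eq (is_diff_mul (is_diff_add Dq1 (is_diff_opp Dq2)) Ds1q2) _.
apply/funext => h; rewrite /newQ1.
move: (q1 c) (q2 c) (s c) q20 s1 (dq1 h) (dq2 h) (ds h).
move=> q1' q2' s' q20' s1' u v r.
by field; rewrite s1' q20'.
Qed.

Lemma is_diff_newP1 : is_diff c (fun y => newP1 (p1 y) (q2 y) (s y))
  (fun h => (s c - 1) * (dp1 h * q2 c + p1 c * dq2 h)
            + ds h * (newP1 (p1 c) (q2 c) (s c) / (s c - 1))).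
Proof.
apply: is_diff_eq (is_diff_mul (is_diff_mul Ds1 Dp1) Dq2) _.
apply/funext => h; rewrite /newP1.
move: (p1 c) (q2 c) (s c) s1 (dp1 h) (dq2 h) (ds h) => p1' q2' s' s1' u v r.
by field.
Qed.

Lemma is_diff_newQ2 : is_diff c (fun y => newQ2 (q2 y) (s y))
  (fun h => s c * dq2 h / ((s c - 1) * q2 c ^+ 2)
            + ds h * (- newQ2 (q2 c) (s c) / (s c * (s c - 1)))).
Proof.
apply: is_diff_eq (is_diff_mul (is_diff_mul Ds Dq21) Ds1q2) _.
apply/funext => h; rewrite /newQ2.
move: (q2 c) (s c) q20 s0 s1 (dq2 h) (ds h) => q2' s' q20' s0' s1' u r.
by field; rewrite s0' s1' q20'.
Qed.

Lemma is_diff_newP2 :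
  is_diff c (fun y => newP2 a0 (q1 y) (p1 y) (q2 y) (p2 y) (s y))
  (fun h => (s c - 1) / s c * (dq2 h * (q1 c * p1 c + q2 c * p2 c + a0)
      + q2 c * (dq1 h * p1 c + q1 c * dp1 h + dq2 h * p2 c + q2 c * dp2 h))
      + ds h * (newP2 a0 (q1 c) (p1 c) (q2 c) (p2 c) (s c)
                / (s c * (s c - 1)))).
Proof.
apply: is_diff_eq (is_diff_mul (is_diff_mul (is_diff_mul Ds1 Dq2)
  (is_diff_add (is_diff_add (is_diff_mul Dq1 Dp1) (is_diff_mul Dq2 Dp2))
     (is_diff_const a0 c))) (is_diff_inv Ds s0)) _.
apply/funext => h; rewrite /newP2.
move: (q1 c) (p1 c) (q2 c) (p2 c) (s c) s0 s1 => q1' p1' q2' p2' s' s0' s1'.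
move: (dq1 h) (dp1 h) (dq2 h) (dp2 h) (ds h) => u1 v1 u2 v2 r.
by field; rewrite s0' s1'.
Qed.

End Components.

Lemma is_diff_new_phase (W : normedModType K) (c : W)
    (z dz : W -> K * K * K * K) (x dx : W -> K * K) :
  is_diff c z dz -> is_diff c x dx ->
  (z c).1.2 != 0 -> (x c).2 != 0 -> (x c).2 != 1 ->
  is_diff c (fun y => new_phase a0 (x y) (z y))
    (fun h => phase_diff (z c) (x c).2 (dz h)
              + (dx h).2 *: drift (x c).2 (new_phase a0 (x c) (z c))).
Proof.
move=> /is_diff_coordsP[Dq1 Dp1 Dq2 Dp2] /is_diff_pairP[_ Ds] q20 s0.
rewrite -subr_eq0 => s1.
have -> : (fun y => new_phase a0 (x y) (z y)) = fun y =>
  (newQ1 (z y).1.1.1 (z y).1.2 (x y).2, newP1 (z y).1.1.2 (z y).1.2 (x y).2,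
   newQ2 (z y).1.2 (x y).2,
   newP2 a0 (z y).1.1.1 (z y).1.1.2 (z y).1.2 (z y).2 (x y).2).
  by apply/funext => y; rewrite new_phaseE.
rewrite new_phaseE; apply/is_diff_coordsP; split.
- exact: (is_diff_newQ1 Dq1 Dq2 Ds q20 s1).
- exact: (is_diff_newP1 Dp1 Dq2 Ds s1).
- exact: (is_diff_newQ2 Dq2 Ds q20 s0 s1).
exact: (is_diff_newP2 Dq1 Dp1 Dq2 Dp2 Ds s0 s1).
Qed.

(** The inverse of the phase map: q2 is recovered from Q2 alone, then q1 from
    Q1, p1 from P1, and finally p2 from P2. *)
Definition old_phase (s : K) w : K * K * K * K :=
  let q2 := s / (s - (s - 1) * w.1.2) in
  let q1 := q2 * (1 + (s - 1) * w.1.1.1) in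
  let p1 := w.1.1.2 / ((s - 1) * q2) in
  (q1, p1, q2, (s * w.2 / ((s - 1) * q2) - a0 - q1 * p1) / q2).

Lemma old_new_phase x z : x.2 != 0 -> x.2 - 1 != 0 -> z.1.2 != 0 ->
  old_phase x.2 (new_phase a0 x z) = z.
Proof.
move=> s0 s1; case: z => [[[q1 p1] q2] p2] /= q20; rewrite /old_phase /=.
have -> : x.2 / (x.2 - (x.2 - 1) * newQ2 q2 x.2) = q2.
  have -> : x.2 - (x.2 - 1) * newQ2 q2 x.2 = x.2 / q2.
    by rewrite /newQ2; field; rewrite s1 q20.
  by field; rewrite ?s0 ?q20.
by rewrite /newQ1 /newP1 /newP2; congr (_, _, _, _); field; rewrite ?s0 ?s1 ?q20.
Qed.

Lemma new_old_phase x w : x.2 != 0 -> x.2 - 1 != 0 ->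
  x.2 - (x.2 - 1) * w.1.2 != 0 -> new_phase a0 x (old_phase x.2 w) = w.
Proof.
case: x => t s /= s0 s1; case: w => [[[Q1 P1] Q2] P2] /= D0.
rewrite /newQ1 /newP1 /newQ2 /newP2.
set q2 := s / _; have q20 : q2 != 0 by rewrite mulf_neq0 ?invr_eq0.
congr (_, _, _, _); try by field; rewrite ?s0 ?s1 ?q20.
by rewrite /q2; field; rewrite ?s0 ?s1 ?D0.
Qed.

Lemma phase_diff_symplectic z (s : K) u v : z.1.2 != 0 -> s != 0 -> s != 1 ->
  symplectic_form (phase_diff z s u) (phase_diff z s v) = symplectic_form u v.
Proof.
rewrite -[s == 1]subr_eq0.
case: z => [[[q1 p1] q2] p2]; case: u => [[[u1 u2] u3] u4].
case: v => [[[v1 v2] v3] v4]; rewrite /symplectic_form /= => q20 s0 s1.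
by field; rewrite s0 s1 q20.
Qed.

(** The equations are solved in the triangular order u3, u1, u2, u4, as for the
    inverse of the phase map. *)
Lemma phase_diff_surj z (s : K) w : z.1.2 != 0 -> s != 0 -> s != 1 ->
  exists u, phase_diff z s u = w.
Proof.
rewrite -[s == 1]subr_eq0.
case: z => [[[q1 p1] q2] p2]; case: w => [[[w1 w2] w3] w4] /= q20 s0 s1.
pose u3 := (s - 1) * q2 ^+ 2 / s * w3.
pose u1 := (s - 1) * q2 * w1 + q1 * u3 / q2.
pose u2 := (w2 / (s - 1) - p1 * u3) / q2.
pose u4 := ((s * w4 / (s - 1) - u3 * (q1 * p1 + q2 * p2 + a0)) / q2
            - u1 * p1 - q1 * u2 - u3 * p2) / q2.
exists (u1, u2, u3, u4); rewrite /phase_diff /= /u4 /u2 /u1 /u3.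
by congr (_, _, _, _); field; rewrite ?s0 ?s1 ?q20.
Qed.

Lemma phase_diff_inj z (s : K) u v :
  z.1.2 != 0 -> s != 0 -> s != 1 ->
  phase_diff z s u = phase_diff z s v -> u = v.
Proof.
move=> q20 s0 s1 uv; apply: symplectic_form_inj => w.
by rewrite -(phase_diff_symplectic u w q20 s0 s1) uv phase_diff_symplectic.
Qed.

Lemma differentiable_old_phase (W : normedModType K) (c : W)
    (w : W -> K * K * K * K) (x : W -> K * K) :
  differentiable w c -> differentiable x c ->
  (x c).2 != 0 -> (x c).2 - 1 != 0 -> (x c).2 - ((x c).2 - 1) * (w c).1.2 != 0 ->
  differentiable (fun y => old_phase (x y).2 (w y)) c.
Proof.
move=> /differentiableP/is_diff_coordsP[[D1 _] [D2 _] [D3 _] [D4 _]].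
move=> /differentiableP/is_diff_pairP[_ [Ds _]] s0 s1 den0.
have Ds1 : differentiable (fun y => (x y).2 - 1) c.
  by apply: differentiableB.
have Dq2 : differentiable
    (fun y => (x y).2 / ((x y).2 - ((x y).2 - 1) * (w y).1.2)) c.
  apply: differentiableM => //; apply: differentiableV => //.
  by apply: differentiableB => //; apply: differentiableM.
have q20 : (x c).2 / ((x c).2 - ((x c).2 - 1) * (w c).1.2) != 0.
  by rewrite mulf_neq0 ?invr_eq0.
pose q2 y := (x y).2 / ((x y).2 - ((x y).2 - 1) * (w y).1.2).
have Dq1 : differentiable (fun y => q2 y * (1 + ((x y).2 - 1) * (w y).1.1.1)) c.
  apply: differentiableM => //; apply: differentiableD => //.
  by apply: differentiableM.
have Di : differentiable (fun y => (((x y).2 - 1) * q2 y)^-1) c.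
  by apply: differentiableV; [exact: differentiableM|rewrite mulf_neq0].
have Dp1 : differentiable (fun y => (w y).1.1.2 / (((x y).2 - 1) * q2 y)) c.
  exact: differentiableM.
apply: differentiable_pair.
  by apply: differentiable_pair => //; exact: differentiable_pair.
apply: differentiableM; last exact: differentiableV.
apply: differentiableB; last exact: differentiableM.
apply: differentiableB => //.
by apply: differentiableM => //; apply: differentiableM.
Qed.

Lemma is_diff_phase x z : time_domain x -> z.1.2 != 0 ->
  is_diff z (new_phase a0 x) (phase_diff z x.2).
Proof.
move=> [_ _ s0 s1 _] q20.
apply: is_diff_eq (@is_diff_new_phase _ z id id (cst x) 0 _ _ q20 s0 s1) _.
by apply/funext => u /=; rewrite scale0r addr0.
Qed.

End PhaseMap.

(** * Birationality *)

Section Birational.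
Variable K : numFieldType.
Variable a0 : K.

Definition inverse_transformation (X : 6.-tuple K) : 6.-tuple K :=
  let t := newT X`_4 X`_5 in let s := newS X`_4 X`_5 in
  let z := old_phase a0 s (X`_0, X`_1, X`_2, X`_3) in
  [tuple z.1.1.1; z.1.1.2; z.1.2; z.2; t; s].

Lemma tuple6_eq (x y : 6.-tuple K) :
  x`_0 = y`_0 -> x`_1 = y`_1 -> x`_2 = y`_2 ->
  x`_3 = y`_3 -> x`_4 = y`_4 -> x`_5 = y`_5 -> x = y.
Proof.
move=> e0 e1 e2 e3 e4 e5; apply/eq_from_tnth => i; rewrite !(tnth_nth 0).
by case: i => -[|[|[|[|[|[|[]]]]]]].
Qed.

Lemma rational_mapP n (F : n.-tuple K -> n.-tuple K) :
  (forall i : 'I_n, rational_fun (fun x => (F x)`_i)) -> rational_map F.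
Proof.
move=> Frat i; have [p [d [d0 Fi]]] := Frat i.
by exists p, d; split=> // x dx; rewrite (tnth_nth 0) Fi.
Qed.

Lemma generically_polynomial n (f : n.-tuple K -> K)
    (P : n.-tuple K -> Prop) x0 :
  polynomial_fun f -> f x0 != 0 -> (forall x, f x != 0 -> P x) -> generically P.
Proof.
move=> [h hE] fx0 fP; exists h; last by move=> x; rewrite -hE; apply: fP.
by apply: contraNneq fx0 => h0; rewrite hE h0 mpoly.meval0.
Qed.

Lemma transformationK (x : 6.-tuple K) :
  x`_2 != 0 -> time_domain (x`_4, x`_5) ->
  inverse_transformation (transformation a0 x) = x.
Proof.
move=> q20 xD; have /time_domainE[/= t0 t1 s0 s1 ts] := xD.
have [tK sK] := new_timesK xD.
have [e0 e1 e2 e3] := @old_new_phase _ a0 (x`_4, x`_5)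
  (x`_0, x`_1, x`_2, x`_3) s0 s1 q20.
by rewrite /inverse_transformation; apply: tuple6_eq; rewrite /= ?tK ?sK.
Qed.

(** Besides the times lying in their domain, q2 = s / (s - (s - 1) Q2) must be finite; in the
    variables (T, S) its denominator is S (T - 1) - (T - S) Q2 up to a
    factor that does not vanish. *)
Lemma inverse_transformationK (X : 6.-tuple K) : time_domain (X`_4, X`_5) ->
  X`_5 * (X`_4 - 1) - (X`_4 - X`_5) * X`_2 != 0 ->
  transformation a0 (inverse_transformation X) = X.
Proof.
move=> XD; have /time_domainE[/= T0 T1 S0 S1 TS] := XD.
have /time_domainE[/= t0 t1 s0 s1 ts] := new_times_domain XD.
have [TK SK] := new_timesK XD => D0.
have q20 : newS X`_4 X`_5 - (newS X`_4 X`_5 - 1) * X`_2 != 0.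
  have -> : newS X`_4 X`_5 - (newS X`_4 X`_5 - 1) * X`_2 =
      (X`_5 * (X`_4 - 1) - (X`_4 - X`_5) * X`_2) / (X`_4 * (X`_5 - 1)).
    by rewrite newS_sub1// /newS; field; rewrite T0 S1.
  by rewrite !(mulf_neq0, invr_eq0).
have [e0 e1 e2 e3] := @new_old_phase _ a0 (newT X`_4 X`_5, newS X`_4 X`_5)
  (X`_0, X`_1, X`_2, X`_3) s0 s1 q20.
by rewrite /inverse_transformation; apply: tuple6_eq.
Qed.

Lemma birational_transformation : birational (transformation a0).
Proof.
split.
  apply: rational_mapP => i.
  rewrite /transformation /newQ1 /newP1 /newQ2 /newP2 /newT /newS.
  by case: i => -[|[|[|[|[|[|[]]]]]]] //= _; rationality.
exists inverse_transformation; split.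
- apply: rational_mapP => i; rewrite /inverse_transformation /old_phase /newT /newS.
  by case: i => -[|[|[|[|[|[|[]]]]]]] //= _; rationality.
(* The polynomial that delimits the exceptional set is nonzero because its value
   at an explicit point, with times 3 and 2, is; likewise for the inverse. *)
- apply: (@generically_polynomial _ (fun x => x`_2 * (x`_4 * (x`_4 - 1) *
    (x`_5 * (x`_5 - 1) * (x`_4 - x`_5)))) _ [tuple 0; 0; 1; 0; 3; 2]).
  + by polynomiality.
  + have -> : 1 * (3 * (3 - 1) * (2 * (2 - 1) * (3 - 2))) = 12%:R :> K by ring.
    by rewrite pnatr_eq0.
  + move=> x; rewrite !mulf_eq0 !negb_or.
    move=> /andP[q20 /andP[/andP[t0 t1] /andP[/andP[s0 s1] ts]]].
    by apply: transformationK => //; apply/time_domainE.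
- apply: (@generically_polynomial _ (fun X => X`_4 * (X`_4 - 1) *
    (X`_5 * (X`_5 - 1) * (X`_4 - X`_5)) *
    (X`_5 * (X`_4 - 1) - (X`_4 - X`_5) * X`_2)) _ [tuple 0; 0; 0; 0; 3; 2]).
  + by polynomiality.
  + have -> : 3 * (3 - 1) * (2 * (2 - 1) * (3 - 2)) * (2 * (3 - 1) - (3 - 2) * 0)
      = 48%:R :> K by ring.
    by rewrite pnatr_eq0.
  + move=> X; rewrite !mulf_eq0 !negb_or.
    move=> /andP[/andP[/andP[t0 t1] /andP[/andP[s0 s1] ts]] D0].
    by apply: inverse_transformationK => //; apply/time_domainE.
Qed.

End Birational.

(** * Pull-back of the Hamiltonians *)

Section Pullback.
Variable K : numFieldType.
Variables a0 a1 a2 a3 a4 a5 : K.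
Hypothesis ha : 2 * a0 + a1 + a2 + a3 + a4 + a5 = 1.
Implicit Types (x h : K * K) (z u w : K * K * K * K).

Local Notation H1a := (H1 a0 a1 a2 a3 a4 a5).
Local Notation H2a := (H2 a0 a1 a2 a3 a4 a5).
Local Notation L1a := (L1 a0 a1 a2 a3 a4 a5).
Local Notation L2a := (L2 a0 a1 a2 a3 a4 a5).

(** The Hamiltonian, in the new variables, of the vector field [drift]: it
    accounts for the dependence of the phase map on s. *)
Definition drift_generator (s : K) w : K :=
  - (w.1.1.1 * w.1.1.2 / (s - 1) + w.1.2 * w.2 / (s * (s - 1))).

Lemma a5E : a5 = 1 - 2 * a0 - a1 - a2 - a3 - a4.
Proof. by apply: (addrI (2 * a0 + a1 + a2 + a3 + a4)); rewrite ha; ring. Qed.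

(** The dt part of the pull-back of L1 dT + L2 dS.  The last summand is the value
    of the difference at q1 = p1 = p2 = 0, q2 = 1; all that matters is that it
    is constant on the phase space. *)
Lemma pullback_dt x z : time_domain x -> z.1.2 != 0 ->
  let X := new_times x in let Z := new_phase a0 x z in
  let t := x.1 in let s := x.2 in
  at_time L1a X Z * (s - 1)^-1 + at_time L2a X Z * (s / ((s - 1) * t ^+ 2))
  = at_time H1a x z
    + a0 * (s * (a0 + a4) - a4 * t - (a0 + a2) * (t ^+ 2 + s * t - s)
            - a1 * s * (t - 1)) / (t * (t - 1) * (t - s)).
Proof.
case: x z => t s [[[q1 p1] q2] p2] /time_domainE[/= t0 t1 s0 s1 ts] q20.
have ST : newS t s - newT t s = - ((t - 1) * (t - s) / (t * (s - 1))).
  by rewrite -opprB newT_subS.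
rewrite /at_time /= /L2 /L1 /HVI newT_subS// ST newT_sub1// newS_sub1//.
rewrite /H1 ha /newT /newS /newQ1 /newQ2 /newP1 /newP2 a5E.
by field; rewrite ?t0 ?t1 ?s0 ?s1 ?ts ?q20.
Qed.

(** The ds part, where the generator of the s-dependence of the phase map appears
    besides H2.  The last summand arises as in the dt part. *)
Lemma pullback_ds x z : time_domain x -> z.1.2 != 0 ->
  let X := new_times x in let Z := new_phase a0 x z in
  let t := x.1 in let s := x.2 in
  at_time L1a X Z * (- ((t - 1) / (s - 1) ^+ 2))
  + at_time L2a X Z * (- ((t - 1) / (t * (s - 1) ^+ 2)))
  = at_time H2a x z + drift_generator s Z
    + a0 * ((a0 + a2) * s * (2 * t - 1) + a1 * t * (s - 1) - (a0 + a5) * t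
            + a5 * s) / (s * (s - 1) * (t - s)).
Proof.
case: x z => t s [[[q1 p1] q2] p2] /time_domainE[/= t0 t1 s0 s1 ts] q20.
have ST : newS t s - newT t s = - ((t - 1) * (t - s) / (t * (s - 1))).
  by rewrite -opprB newT_subS.
have st : s - t != 0 by rewrite -opprB oppr_eq0.
have ha' : 2 * a0 + a1 + a2 + a3 + a5 + a4 = 1 by rewrite addrAC.
rewrite /drift_generator /at_time /= /L2 /L1 /HVI newT_subS// ST.
rewrite newT_sub1// newS_sub1//.
rewrite /H2 /H1 ha' /newT /newS /newQ1 /newQ2 /newP1 /newP2 a5E.
by field; rewrite ?t0 ?t1 ?s0 ?s1 ?ts ?st ?q20.
Qed.

Lemma is_diff_drift_generator (s : K) w :
  is_diff w (drift_generator s) (fun v => - symplectic_form (drift s w) v).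
Proof.
have [D1 D2 D3 D4] := (@is_diff_coordsP _ _ w id id).1 (is_diff_id w).
apply: is_diff_eq (is_diff_opp (is_diff_add
  (is_diff_mul (is_diff_mul D1 D2) (is_diff_const (s - 1)^-1 w))
  (is_diff_mul (is_diff_mul D3 D4) (is_diff_const (s * (s - 1))^-1 w)))) _.
by apply/funext => v; rewrite /symplectic_form /drift /=; ring.
Qed.

Lemma near_q2_neq0 z : z.1.2 != 0 -> \forall y \near z, y.1.2 != 0.
Proof.
have [_ _ [D3 _] _] := (@is_diff_coordsP _ _ z id id).1 (is_diff_id z).
exact: (near_neq0 D3).
Qed.

(** Every tangent vector [w] at the image is the image of some [u].  Pairing
    both sides with it leaves, by symplecticity, the differentials of H1 and
    H2 along [u] on the left and those of L1 and L2 composed with the phase map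
    on the right; the differentiated pull-back identities relate them. *)
Lemma phase_diff_field x z h : time_domain x -> z.1.2 != 0 ->
  let X := new_times x in let Z := new_phase a0 x z in
  phase_diff a0 z x.2 (h.1 *: ham_field H1a z x + h.2 *: ham_field H2a z x)
    + h.2 *: drift x.2 Z
  = (times_diff x h).1 *: ham_field L1a Z X
    + (times_diff x h).2 *: ham_field L2a Z X.
Proof.
move=> xD q20 X Z; have [_ _ s0 s1 _] := xD.
have XD : time_domain X by exact: new_times_domain.
apply: symplectic_form_inj => w.
have [u <-] := phase_diff_surj a0 w q20 s0 s1.
rewrite symplectic_formD phase_diff_symplectic//.
rewrite !(symplectic_formD, symplectic_formZ).
have dH1 := differentiable_hamiltonian z
  (polynomial_H1 a0 a1 a2 a3 a4 a5) xD.
have dH2 := differentiable_hamiltonian z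
  (polynomial_H2 a0 a1 a2 a3 a4 a5) xD.
have dL1 := differentiable_hamiltonian Z
  (polynomial_L1 a0 a1 a2 a3 a4 a5) XD.
have dL2 := differentiable_hamiltonian Z
  (polynomial_L2 a0 a1 a2 a3 a4 a5) XD.
rewrite !ham_field_diff//.
have DF := is_diff_phase a0 xD q20.
have DL1 := is_diff_comp DF (differentiableP dL1).
have DL2 := is_diff_comp DF (differentiableP dL2).
have Dk (k : K) : is_diff z (fun=> k) (fun=> 0) by exact: is_diff_const.
have et := is_diff_unique
  (near_eq_is_diff (filterS (fun y => @pullback_dt x y xD) (near_q2_neq0 q20))
    (is_diff_add (is_diff_mul DL1 (Dk _)) (is_diff_mul DL2 (Dk _))))
  (is_diff_add (differentiableP dH1) (Dk _)).
have es := is_diff_unique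
  (near_eq_is_diff (filterS (fun y => @pullback_ds x y xD) (near_q2_neq0 q20))
    (is_diff_add (is_diff_mul DL1 (Dk _)) (is_diff_mul DL2 (Dk _))))
  (is_diff_add (is_diff_add (differentiableP dH2)
    (is_diff_comp DF (is_diff_drift_generator x.2 Z))) (Dk _)).
(* Pure linear algebra, isolated over variables because normalising the
   concrete terms is expensive; the zeros come from the product rule. *)
have combine (k11 k12 k21 k22 b1 b2 l1 l2 d1 d2 o r1 r2 : K) :
    b1 * 0 + k11 * l1 + (b2 * 0 + k12 * l2) = d1 + 0 ->
    b1 * 0 + - k21 * l1 + (b2 * 0 + - k22 * l2) = d2 + - o + 0 ->
    r1 * - d1 + r2 * - d2 + r2 * o
    = (r1 * k11 - k21 * r2) * - l1 + (k12 * r1 - k22 * r2) * - l2.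
  rewrite !(mulr0, add0r, addr0) => <- e2.
  by rewrite -addrA -mulrDr [_ + o]addrC -opprB -e2; ring.
exact: combine (congr1 (fun f => f u) (et _)) (congr1 (fun f => f u) (es _)).
Qed.

End Pullback.

(** * Transport of the systems *)

Section Transport.
Variable K : numFieldType.
Variable a0 : K.
Implicit Types (x h : K * K).

Variables (U : set (K * K)) (z Z : K * K -> K * K * K * K).
Hypothesis Uopen : open U.
Hypothesis U_domain : U `<=` @time_domain K.
Hypothesis q20 : forall x, U x -> (z x).1.2 != 0.
Hypothesis ZE : forall x, U x -> Z (new_times x) = new_phase a0 x (z x).

(** Near the new times, Z = Phi (z (t, s), (t, s)) where (t, s) is the image of
    (T, S) under the involutive change of times, so Z inherits its differential
    from z by the chain rule. *)
Lemma transport_is_diff x (dz : K * K -> K * K * K * K) : U x ->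
  is_diff x z dz ->
  is_diff (new_times x) Z (fun h =>
    phase_diff a0 (z x) x.2 (dz (times_diff (new_times x) h))
    + (times_diff (new_times x) h).2 *: drift x.2 (Z (new_times x))).
Proof.
move=> Ux Dz; have xD := U_domain Ux; have [_ _ s0 s1 _] := xD.
have XD := new_times_domain xD; have xK := new_timesK xD.
have Dt := is_diff_times XD.
have Dzt : is_diff (new_times x) (fun X => z (new_times X))
    (fun h => dz (times_diff (new_times x) h)).
  by apply: is_diff_comp; rewrite xK.
have := @is_diff_new_phase _ a0 _ _ _ _ _ _ Dzt Dt.
lazy beta; rewrite xK -(ZE Ux) => /(_ (q20 Ux) s0 s1); apply: near_eq_is_diff.
have nearU : \forall X \near new_times x, U (new_times X).
  have /differentiable_continuous ct := @ex_diff _ _ _ _ _ _ _ Dt.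
  by apply: ct; rewrite xK; exact: open_nbhs_nbhs.
have nearD := near_time_domain XD.
near=> X; have UX : U (new_times X) by near: X.
have XDom : time_domain X by near: X.
by rewrite -ZE// new_timesK.
Unshelve. all: by end_near. Qed.

(** Only the existence of the differential of z is needed here: its value
    follows from that of Z by injectivity of [phase_diff]. *)
Lemma transport_differentiable x : U x ->
  differentiable Z (new_times x) -> differentiable z x.
Proof.
move=> Ux DZ; have xD := U_domain Ux; have [_ _ s0 s1 _] := xD.
have s1' : x.2 - 1 != 0 by rewrite subr_eq0.
have [Dt _] := is_diff_times xD.
have DZt : differentiable (Z \o @new_times K) x by exact: differentiable_comp.
have den0 : x.2 - (x.2 - 1) * (Z (new_times x)).1.2 != 0.
  rewrite ZE// new_phaseE /= /newQ2.
  have -> : x.2 - (x.2 - 1) * (x.2 * ((z x).1.2 - 1) / ((x.2 - 1) * (z x).1.2))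
      = x.2 / (z x).1.2.
    by field; rewrite s1' q20.
  by rewrite mulf_neq0 ?invr_eq0 ?q20.
have [Did _] := is_diff_id x.
have D := differentiable_old_phase a0 DZt Did s0 s1' den0.
apply: (@ex_diff _ _ _ _ _ _ _ (near_eq_is_diff _ (differentiableP D))).
have nearU : \forall y \near x, U y by exact: open_nbhs_nbhs.
near=> y; have Uy : U y by near: y.
have [_ _ sy0 sy1 _] := U_domain Uy.
by rewrite /= ZE// old_new_phase ?subr_eq0 ?q20.
Unshelve. all: by end_near. Qed.

Variables a1 a2 a3 a4 a5 : K.
Hypothesis ha : 2 * a0 + a1 + a2 + a3 + a4 + a5 = 1.

Lemma hamiltonian_system_transport x : U x ->
  (hamiltonian_system_at (H1 a0 a1 a2 a3 a4 a5) (H2 a0 a1 a2 a3 a4 a5) z x <->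
   hamiltonian_system_at (L1 a0 a1 a2 a3 a4 a5) (L2 a0 a1 a2 a3 a4 a5) Z
     (new_times x)).
Proof.
move=> Ux; have xD := U_domain Ux; have [_ _ s0 s1 _] := xD.
have xK := new_timesK xD; have XD := new_times_domain xD.
have field_eq h := phase_diff_field ha (times_diff (new_times x) h) xD (q20 Ux).
have hK h : times_diff x (times_diff (new_times x) h) = h.
  by have := times_diffK h XD; rewrite xK.
split=> /hamiltonian_system_atE D; apply/hamiltonian_system_atE.
  apply: is_diff_eq (transport_is_diff Ux D) _.
  by apply/funext => h; rewrite ZE// field_eq hK.
have [DZ _] := D.
(* Both expressions of the differential of Z are compared on the images of
   tangent vectors at the old times. *)
have Dz := differentiableP (transport_differentiable Ux DZ).
apply: (is_diff_eq Dz); apply/funext => h.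
have /(congr1 (fun f => f (times_diff x h))) :=
  is_diff_unique (transport_is_diff Ux Dz) D.
lazy beta; rewrite times_diffK// ZE// -(phase_diff_field ha h xD (q20 Ux)).
move=> e; apply: (phase_diff_inj (q20 Ux) s0 s1).
exact: (addIr (h.2 *: drift x.2 (new_phase a0 x (z x)))) e.
Qed.

End Transport.

Unset Implicit Arguments.

Theorem proposition2p2 (R : realType) (a0 a1 a2 a3 a4 a5 : complexes R)
    (ha : 2 * a0 + a1 + a2 + a3 + a4 + a5 = 1) :
  [/\ birational (transformation a0),
      (forall x : complexes R * complexes R, time_domain x ->
         symplectic_on [set z | z.1.2 != 0] (new_phase a0 x)),
      polynomial_hamiltonian (L1 a0 a1 a2 a3 a4 a5),
      polynomial_hamiltonian (L2 a0 a1 a2 a3 a4 a5) &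
      forall (U : set (complexes R * complexes R))
          (z Z : complexes R * complexes R ->
                 complexes R * complexes R * complexes R * complexes R),
        open U -> U `<=` @time_domain (complexes R) ->
        (forall x, U x -> (z x).1.2 != 0) ->
        (forall x, U x -> Z (new_times x) = new_phase a0 x (z x)) ->
        (forall x, U x ->
           (hamiltonian_system_at (H1 a0 a1 a2 a3 a4 a5)
              (H2 a0 a1 a2 a3 a4 a5) z x <->
            hamiltonian_system_at (L1 a0 a1 a2 a3 a4 a5)
              (L2 a0 a1 a2 a3 a4 a5) Z (new_times x))) /\
        (solution_on (H1 a0 a1 a2 a3 a4 a5) (H2 a0 a1 a2 a3 a4 a5) U z <->
         solution_on (L1 a0 a1 a2 a3 a4 a5) (L2 a0 a1 a2 a3 a4 a5)
           (@new_times (complexes R) @` U) Z)].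
Proof.
split.
- exact: birational_transformation.
- move=> x xD z q20; have [F_diff dF] := is_diff_phase a0 xD q20.
  split=> // u v; rewrite dF; have [_ _ s0 s1 _] := xD.
  exact: phase_diff_symplectic.
- exact: polynomial_L1.
- exact: polynomial_L2.
move=> U z Z Uopen U_domain q20 ZE.
have equiv x := hamiltonian_system_transport Uopen U_domain q20 ZE ha (x := x).
split=> //; split=> [sol _ [x Ux <-]|sol x Ux].
  exact/(equiv x Ux)/sol.
by apply/(equiv x Ux)/sol; exists x.
Qed.
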